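(* Let $R$ be an associative ring with identity. There is no nonzero injective Kleisli convolution representation of $R$. More precisely, if $M$ is an injective left $R$-module and its underlying Abelian group is free of finite rank, then $M=0$.
   Context: All modules are unital left modules, ring homomorphisms are unital. Let $\mathbf 1=\{\bullet\}$, and for a finite set $X$ put $E_X=X\times X$. For a set $X$, $\mathcal M_{\mathbb Z}(X)$ is the free Abelian group of finite formal sums $\sum_{x\in X}a_x[x]$; $\mathscr M_{\mathbb Z}$ is the corresponding free Abelian group monad on $\mathsf{Set}$. A Kleisli arrow $f:X\rightsquigarrow Y$ is a map $f:X\to\mathcal M_{\mathbb Z}(Y)$. For finite $X$, $\mathbb H_{\mathbb Z}(X)=\mathrm{Hom}_{\mathsf{Kl}(\mathscr M_{\mathbb Z})}(\mathbf 1,E_X)$ is a ring with pointwise addition and Kleisli convolution as multiplication: if $f(\bullet)=\sum f_{i,j}[(i,j)]$ and $g(\bullet)=\sum g_{i,j}[(i,j)]$ then $(f\ast g)(\bullet)=\sum_{i,q}(\sum_j f_{i,j}g_{j,q})[(i,q)]$; its unit is $u_X(\bullet)=\sum_x[(x,x)]$. $\Phi_X:\mathbb H_{\mathbb Z}(X)\to\mathrm{Mat}_X(\mathbb Z)$, $f\mapsto(f_{i,j})$, is a ring isomorphism. A Kleisli convolution representation of $R$ is a pair $(X,\varrho)$ with $X$ a finite set and $\varrho:R\to\mathbb H_{\mathbb Z}(X)$ a unital ring homomorphism; the one on the empty set is the zero object. Its associated left $R$-module is $M_{\varrho}=\mathbb Z^{(X)}$ with action $r\cdot v=\Phi_X(\varrho(r))v$.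 The representation $(X,\varrho)$ is called injective if $M_{\varrho}$ is injective in the category $R\text{-}\mathsf{Mod}$ of left $R$-modules. *)

(* Defs.v *)
From HB Require Import structures.
From mathcomp Require Import all_boot all_order all_algebra.
From mathcomp.multinomials Require Import freeg.

Set Implicit Arguments.
Unset Strict Implicit.
Unset Printing Implicit Defensive.

Import GRing.Theory.
Local Open Scope ring_scope.

(* Only arrows with a finite source occur, so they are packaged as finite
   functions: this makes pointwise equality coincide with Leibniz equality and
   supplies the pointwise additive group structure. *)
Definition kleisli_arrow (X : finType) (Y : choiceType) : Type :=
  {ffun X -> {freeg Y / int}}.

Definition HZ (X : finType) : Type := kleisli_arrow unit (X * X)%type.

HB.instance Definition _ (X : finType) :=
  GRing.Zmodule.copy (HZ X) {ffun unit -> {freeg (X * X)%type / int}}.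

Section Convolution.

Variable X : finType.

(* The integer matrix (f_{i,j}) of f(tt) = \sum_(i, j) f_{i,j} [(i, j)]. *)
Definition Phi (f : HZ X) (i j : X) : int := coeff (i, j) (f tt).

Definition kconv (f g : HZ X) : HZ X :=
  [ffun => \sum_(i : X) \sum_(q : X)
             << (\sum_(j : X) Phi f i j * Phi g j q) *g (i, q) >>].

Definition kunit : HZ X := [ffun => \sum_(x : X) << 1 *g (x, x) >>].

Lemma Phi_inj (f g : HZ X) : (forall i j, Phi f i j = Phi g i j) -> f = g.
Proof.
move=> e; apply/ffunP; case; apply/eqP/freeg_eqP; case=> i j; exact: e.
Qed.

Lemma PhiD (f g : HZ X) i j : Phi (f + g) i j = Phi f i j + Phi g i j.
Proof. by rewrite /Phi ffunE coeffD. Qed.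

Lemma Phi_conv (f g : HZ X) i q :
  Phi (kconv f g) i q = \sum_(j : X) Phi f i j * Phi g j q.
Proof.
rewrite {1}/Phi ffunE raddf_sum (bigD1 i) //= raddf_sum (bigD1 q) //=.
rewrite coeffU eqxx mulr1 -addrA -[RHS]addr0; congr (_ + _).
rewrite big1 => [|k nk]; last first.
  by rewrite coeffU xpair_eqE (negbTE nk) andbF mulr0.
rewrite add0r big1 // => k nk; rewrite raddf_sum big1 // => l _ /=.
by rewrite coeffU xpair_eqE (negbTE nk) mulr0.
Qed.

Lemma Phi_unit i j : Phi kunit i j = (i == j)%:R.
Proof.
rewrite /Phi ffunE raddf_sum (bigD1 i) //= coeffU xpair_eqE eqxx mul1r /=.
rewrite big1 ?addr0 // => k nk.
by rewrite coeffU xpair_eqE (negbTE nk) mulr0.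
Qed.

Lemma kconvA : associative kconv.
Proof.
move=> f g h; apply: Phi_inj => i q; rewrite !Phi_conv.
under eq_bigr do rewrite Phi_conv mulr_sumr.
rewrite exchange_big; apply: eq_bigr => k _.
by rewrite Phi_conv mulr_suml; apply: eq_bigr => j _; rewrite mulrA.
Qed.

Lemma kconv1l : left_id kunit kconv.
Proof.
move=> f; apply: Phi_inj => i q; rewrite Phi_conv (bigD1 i) //= big1.
  by rewrite Phi_unit eqxx mul1r addr0.
by move=> j nj; rewrite Phi_unit eq_sym (negbTE nj) mul0r.
Qed.

Lemma kconv1r : right_id kunit kconv.
Proof.
move=> f; apply: Phi_inj => i q; rewrite Phi_conv (bigD1 q) //= big1.
  by rewrite Phi_unit eqxx mulr1 addr0.
by move=> j nj; rewrite Phi_unit (negbTE nj) mulr0.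
Qed.

Lemma kconvDl : left_distributive kconv +%R.
Proof.
move=> f g h; apply: Phi_inj => i q; rewrite PhiD !Phi_conv -big_split /=.
by apply: eq_bigr => j _; rewrite PhiD mulrDl.
Qed.

Lemma kconvDr : right_distributive kconv +%R.
Proof.
move=> f g h; apply: Phi_inj => i q; rewrite PhiD !Phi_conv -big_split /=.
by apply: eq_bigr => j _; rewrite PhiD mulrDr.
Qed.

(* HZ X is the zero ring when X is empty, hence pzRing rather than nzRing. *)
HB.instance Definition _ := GRing.Zmodule_isPzRing.Build (HZ X)
  kconvA kconv1l kconv1r kconvDl kconvDr.

End Convolution.

Record kconv_rep (R : pzRingType) := KConvRep {
  rep_set : finType;
  rep_map : {rmorphism R -> HZ rep_set}
}.

(* The zero object among representations is the one on the empty set. *)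
Definition zero_rep (R : pzRingType) (rho : kconv_rep R) : Prop :=
  #|rep_set rho| = 0%N.

(* Z^(X), with action r . v = Phi_X(rho(r)) v.  A separate type, because
   {ffun X -> int} does not determine rho. *)
Definition rep_module (R : pzRingType) (rho : kconv_rep R) : Type :=
  {ffun rep_set rho -> int}.

HB.instance Definition _ (R : pzRingType) (rho : kconv_rep R) :=
  GRing.Zmodule.copy (rep_module rho) {ffun rep_set rho -> int}.

Section AssociatedModule.

Variables (R : pzRingType) (rho : kconv_rep R).

Definition rep_act (r : R) (v : rep_module rho) : rep_module rho :=
  [ffun i => \sum_(j : rep_set rho) Phi (rep_map rho r) i j * v j].

Lemma rep_actA a b v : rep_act a (rep_act b v) = rep_act (a * b) v.
Proof.
apply/ffunP => i; rewrite !ffunE rmorphM.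
under eq_bigr do rewrite ffunE mulr_sumr.
rewrite exchange_big; apply: eq_bigr => k _.
by rewrite Phi_conv mulr_suml; apply: eq_bigr => j _; rewrite mulrA.
Qed.

Lemma rep_act1 : left_id 1 rep_act.
Proof.
move=> v; apply/ffunP => i; rewrite ffunE rmorph1 (bigD1 i) //= big1.
  by rewrite Phi_unit eqxx mul1r addr0.
by move=> j nj; rewrite Phi_unit eq_sym (negbTE nj) mul0r.
Qed.

Lemma rep_actDr : right_distributive rep_act +%R.
Proof.
move=> a u v; apply/ffunP => i; rewrite !ffunE -big_split /=.
by apply: eq_bigr => j _; rewrite ffunE mulrDr.
Qed.

Lemma rep_actDl v : {morph rep_act^~ v : a b / a + b}.
Proof.
move=> a b; apply/ffunP => i; rewrite !ffunE rmorphD -big_split /=.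
by apply: eq_bigr => j _; rewrite PhiD mulrDl.
Qed.

HB.instance Definition _ := GRing.Zmodule_isLmodule.Build R (rep_module rho)
  rep_actA rep_act1 rep_actDr rep_actDl.

End AssociatedModule.

Definition injective_module (R : pzRingType) (M : lmodType R) : Prop :=
  forall (A B : lmodType R) (i : {linear A -> B}) (f : {linear A -> M}),
    injective i -> exists g : {linear B -> M}, forall a : A, g (i a) = f a.

Definition injective_rep (R : pzRingType) (rho : kconv_rep R) : Prop :=
  injective_module (rep_module rho : lmodType R).

Definition free_of_finite_rank (M : zmodType) : Prop :=
  exists (n : nat) (phi : {additive M -> 'rV[int]_n}), bijective phi.

(* Main.v *)
Require Import Defs.
From mathcomp Require Import all_boot all_order all_algebra.
From HB Require Import structures.

Import GRing.Theory Num.Theory.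

(** A torsion-free injective module M is divisible as an abelian group.
    Indeed, for k > 0 the map m |-> k m is R-linear, whatever the ring R,
    because integer multiples commute with scalars; it is injective because M
    is torsion-free; so by injectivity of M the identity of M extends along
    it, which gives an R-linear g with g (k m) = m, that is k (g m) = m
    ([injective_module_divisible]).  The case k = 2 already excludes a
    nonzero M that is free of finite rank: each coordinate of a vector of M
    could be halved over and over again, so it is 0 ([halvable_eq0]).

    The statement on representations is the special case M = Z^(X), where the
    constant vector 1 is nonzero as soon as X has a point. *)

Section NaturalMultiples.

Local Open Scope ring_scope.

Context (R : pzRingType) (M : lmodType R) (k : nat).

Definition natmul_map (m : M) : M := m *+ k.

Lemma natmul_map_linear : linear natmul_map.
Proof. by move=> a u v; rewrite /natmul_map mulrnDl scalerMnr. Qed.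

HB.instance Definition _ :=
  GRing.isLinear.Build R M M *:%R natmul_map natmul_map_linear.

(** The witness is the value at m of an R-linear retraction of multiplication
    by k; k is then cancelled on the other side by linearity. *)
Lemma injective_module_divisible :
  injective_module M -> injective natmul_map ->
  forall m : M, exists m' : M, m = m' *+ k.
Proof.
move=> injM inj_k m; have [g gK] := injM M M natmul_map idfun inj_k.
by exists (g m); rewrite -raddfMn -[RHS]/(g (natmul_map m)) gK.
Qed.

End NaturalMultiples.

Section FreeOfFiniteRank.

Local Open Scope ring_scope.

(** Infinite descent on the absolute value of [c v]: if v = 2 w then
    [c w] is half of [c v].  In the application c is a coordinate of a vector
    in a basis. *)
Lemma halvable_eq0 (V : zmodType) (c : V -> int) :
    {morph c : u / u *+ 2} -> (forall v : V, exists w : V, v = w *+ 2) ->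
  forall v, c v = 0.
Proof.
move=> c2 halvable v; have [N] := ubnP `|c v|%N.
elim: N v => // N IHN v; have [w ->] := halvable v; rewrite c2 => ltN.
have [->|cw_neq0] := eqVneq (c w) 0; first by rewrite mul0rn.
rewrite IHN ?mul0rn //; apply: leq_trans (ltN : (`|c w *+ 2| <= N)%N).
rewrite -mulr_natr abszM muln2 -addnn.
by rewrite -[X in (X < _)%N]add0n ltn_add2r absz_gt0.
Qed.

Lemma injective_free_module_eq0 (R : pzRingType) (M : lmodType R) :
  injective_module M -> free_of_finite_rank M -> forall m : M, m = 0.
Proof.
move=> injM [n [phi phi_bij]] m; have phi_inj := bij_inj phi_bij.
have inj2 : injective (natmul_map R M 2).
  move=> u v; rewrite /natmul_map => /(congr1 phi); rewrite !raddfMn => e.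
  apply/phi_inj/rowP => j; have /rowP/(_ j) := e; rewrite !mulmxnE.
  exact: (pmulrnI (isT : (0 < 2)%N)).
apply/phi_inj/rowP => j; rewrite raddf0 mxE.
apply: (halvable_eq0 M (fun v => phi v 0 j)) => [v|].
  by rewrite raddfMn mulmxnE.
exact: (injective_module_divisible R M 2 injM inj2).
Qed.

Lemma rep_module_free (R : pzRingType) (rho : kconv_rep R) :
  free_of_finite_rank (rep_module rho).
Proof.
pose row_of (v : rep_module rho) : 'rV[int]_#|rep_set rho| :=
  \row_i v (enum_val i).
have row_of_additive : zmod_morphism row_of.
  by move=> u v; apply/rowP => i; rewrite !mxE !ffunE.
pose ha := GRing.isZmodMorphism.Build _ _ row_of row_of_additive.
pose phi : {additive rep_module rho -> 'rV[int]_#|rep_set rho|} :=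
  HB.pack row_of ha.
exists #|rep_set rho|, phi.
exists (fun w : 'rV[int]_#|rep_set rho| => [ffun x => w 0 (enum_rank x)]) => [v|w].
  by apply/ffunP => x; rewrite ffunE mxE enum_rankK.
by apply/rowP => i; rewrite mxE ffunE enum_valK.
Qed.

End FreeOfFiniteRank.

Theorem proposition5p15 (R : pzRingType) :
  (~ exists rho : kconv_rep R, ~ zero_rep rho /\ injective_rep rho) /\
  (forall M : lmodType R,
     injective_module M -> free_of_finite_rank M -> forall m : M, m = 0%R).
Proof.
split=> [[rho [rho_neq0 rho_inj]]|M]; last exact: injective_free_module_eq0.
apply: rho_neq0; apply: eq_card0 => x.
pose ones : rep_module rho := [ffun=> 1%R].
have /ffunP/(_ x) : ones = 0%R.
  exact: injective_free_module_eq0 rho_inj (rep_module_free R rho) ones.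
by rewrite !ffunE.
Qed.
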